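(* Let $G=\mathbb{R}^k\ltimes_\phi\mathbb{R}^{s+2n}$ be a splittable flat Lie group and let $\Gamma$ be a splittable lattice of $G$ given by $\Gamma=\left(\bigoplus_{i=1}^k\mathbb{Z}X_i\right)\ltimes_\phi P\mathbb{Z}^{s+2n}$, where $\{X_1,\ldots,X_k\}$ is a basis of $\mathbb{R}^k$, $P\in\mathrm{GL}_{s+2n}(\mathbb{R})$ and $E_i:=P^{-1}\exp(\mathrm{ad}_{X_i})P$ is an integer matrix for $1\le i\le k$. Then $\mathrm{Hol}(\Gamma\backslash G)\cong\langle E_1,\ldots,E_k\rangle$, the subgroup of $\mathrm{GL}(s+2n,\mathbb{Z})$ generated by $E_1,\ldots,E_k$.
   Context: A flat Lie group is a simply-connected Lie group $G$ with a flat left invariant Riemannian metric. Its Lie algebra $\mathfrak{g}$ splits orthogonally as $\mathfrak{g}=\mathfrak{b}\oplus\mathfrak{z}(\mathfrak{g})\oplus[\mathfrak{g},\mathfrak{g}]$, where $\mathfrak{b}\cong\mathbb{R}^k$ is an abelian subalgebra, $\mathfrak{z}(\mathfrak{g})$ is the center, $\dim\mathfrak{z}(\mathfrak{g})=s$, $[\mathfrak{g},\mathfrak{g}]$ is abelian of even dimension $2n$, $\mathrm{ad}:\mathfrak{b}\to\mathfrak{so}([\mathfrak{g},\mathfrak{g}])$ is injective, and $\mathfrak{z}(\mathfrak{g})\oplus[\mathfrak{g},\mathfrak{g}]\cong\mathbb{R}^{s+2n}$ is the nilradical. Accordingly $G=\mathbb{R}^k\ltimes_\phi\mathbb{R}^{s+2n}$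 with $\phi\left(\sum_i t_iX_i\right)=\prod_i\exp(t_i\,\mathrm{ad}_{X_i})$, where $\mathrm{ad}_{X}$ denotes the restriction of $\mathrm{ad}_X$ to $\mathbb{R}^{s+2n}$, for $X\in\mathfrak{b}\cong\mathbb{R}^k$. A lattice is a discrete cocompact subgroup; it is splittable if it is of the form $\Gamma_1\ltimes_\phi\Gamma_2$ with $\Gamma_1,\Gamma_2$ lattices of $\mathbb{R}^k$ and $\mathbb{R}^{s+2n}$. $\mathrm{Hol}(\Gamma\backslash G)$ is the holonomy group of the compact flat Riemannian manifold $\Gamma\backslash G$; since $\Gamma$ is a Bieberbach group, it is identified with the finite group $\Gamma/\Lambda$, where $\Lambda$ is the translation subgroup of $\Gamma$, i.e. the unique maximal normal abelian subgroup of $\Gamma$. *)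

(* Defs.v *)
From HB Require Import structures.
From mathcomp Require Import all_boot all_order all_algebra.
From mathcomp Require Import all_classical all_reals all_analysis.
Set Implicit Arguments.
Unset Strict Implicit.
Unset Printing Implicit Defensive.
Import Order.TTheory GRing.Theory Num.Theory.
Import numFieldNormedType.Exports.
Local Open Scope classical_set_scope.
Local Open Scope ring_scope.

Section MetricLieAlgebra.
Variables (R : realType) (V : lmodType R).
Implicit Types (br nabla : V -> V -> V) (ip : V -> V -> R).

Definition is_lie_bracket br : Prop :=
  [/\ forall x, linear (br x), forall y, linear (br^~ y),
      forall x, br x x = 0
    & forall x y z, br x (br y z) + br y (br z x) + br z (br x y) = 0].

Definition is_inner_product ip : Prop :=
  [/\ forall x, scalar (ip x), forall x y, ip x y = ip y x
    & forall x, x != 0 -> 0 < ip x x].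

(* The Levi-Civita connection of the left invariant metric [ip], restricted
   to left invariant vector fields: bilinear, torsion free and metric. *)
Definition is_levi_civita br ip nabla : Prop :=
  [/\ forall x, linear (nabla x), forall y, linear (nabla^~ y),
      forall x y, nabla x y - nabla y x = br x y
    & forall x y z, ip (nabla x y) z + ip y (nabla x z) = 0].

Definition is_flat br ip : Prop :=
  exists2 nabla, is_levi_civita br ip nabla
    & forall x y z,
        nabla x (nabla y z) - nabla y (nabla x z) - nabla (br x y) z = 0.

Definition lie_center br : set V := [set x | forall y, br x y = 0].

(* Finite sums of brackets already form a subspace when [br] is bilinear. *)
Definition lie_derived br : set V :=
  [set x | exists r : seq (V * V), x = \sum_(p <- r) br p.1 p.2].

End MetricLieAlgebra.

(* The data of a simply connected Lie group with a flat left invariant metric: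
   its Lie algebra, and the inner product on it.
   The carrier 'cV_k * 'cV_(s + 2 * n) puts the orthogonal splitting
   b + z(g) + [g, g] in coordinates: b is the first component and the two
   blocks of the second one are z(g) and [g, g]. The inner product itself is
   not assumed to be the standard one in these coordinates. *)
Record flatLieAlgebra (R : realType) (k s n : nat) := FlatLieAlgebra {
  lie_br : 'cV[R]_k * 'cV[R]_(s + 2 * n) -> 'cV[R]_k * 'cV[R]_(s + 2 * n) ->
           'cV[R]_k * 'cV[R]_(s + 2 * n);
  lie_ip : 'cV[R]_k * 'cV[R]_(s + 2 * n) -> 'cV[R]_k * 'cV[R]_(s + 2 * n) -> R;
  lie_brP : is_lie_bracket lie_br;
  lie_ipP : is_inner_product lie_ip;
  lie_flat : is_flat lie_br lie_ip;
  lie_centerE : lie_center lie_br = [set (0, col_mx c 0) | c in setT];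
  lie_derivedE : lie_derived lie_br = [set (0, col_mx 0 d) | d in setT];
  lie_orthE : forall (t : 'cV[R]_k) (c : 'cV[R]_s) (d : 'cV[R]_(2 * n)),
    [/\ lie_ip (t, 0) (0, col_mx c 0) = 0,
        lie_ip (t, 0) (0, col_mx 0 d) = 0
      & lie_ip (0, col_mx c 0) (0, col_mx 0 d) = 0];
  lie_b_abelian : forall t t' : 'cV[R]_k, lie_br (t, 0) (t', 0) = 0;
  lie_derived_abelian : forall d d' : 'cV[R]_(2 * n),
    lie_br (0, col_mx 0 d) (0, col_mx 0 d') = 0;
  lie_ad_skew : forall (t : 'cV[R]_k) (d d' : 'cV[R]_(2 * n)),
    lie_ip (lie_br (t, 0) (0, col_mx 0 d)) (0, col_mx 0 d') +
    lie_ip (0, col_mx 0 d) (lie_br (t, 0) (0, col_mx 0 d')) = 0;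
  lie_ad_inj : forall t : 'cV[R]_k,
    (forall d : 'cV[R]_(2 * n), lie_br (t, 0) (0, col_mx 0 d) = 0) -> t = 0
}.

Definition ad_mx (R : realType) (k s n : nat) (F : flatLieAlgebra R k s n)
    (x : 'cV[R]_k) : 'M[R]_(s + 2 * n) :=
  \matrix_(i, j) (lie_br F (x, 0) (0, delta_mx j 0)).2 i 0.

HB.instance Definition _ (R : realType) (m n : nat) := Complete.on 'M[R]_(m, n).

Section MatrixExponential.
Variables (R : realType) (m : nat).
Implicit Types A B : 'M[R]_m.

Definition exp_mx_coeff A (l : nat) : 'M[R]_m := (l`!%:R : R)^-1 *: A ^+ l.

Definition exp_mx A : 'M[R]_m := limn (series (exp_mx_coeff A)).

Lemma ler_norm_entry A i j : `|A i j| <= `|A|.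
Proof.
by rewrite [leRHS]/Num.Def.normr /= mx_normrE; apply/bigmax_geP; right; exists (i, j).
Qed.

Lemma ler_mx_norm A (c : R) :
  0 <= c -> (forall i j, `|A i j| <= c) -> `|A| <= c.
Proof.
by move=> c0 Ac; rewrite [leLHS]/Num.Def.normr /= mx_normrE; apply/bigmax_leP; split.
Qed.

Lemma ler_norm_mulmx A B : `|A * B| <= m%:R * `|A| * `|B|.
Proof.
apply: ler_mx_norm => [|i j]; first by rewrite !mulr_ge0.
rewrite mxE (le_trans (ler_norm_sum _ _ _))//.
apply: (@le_trans _ _ (\sum_(l < m) `|A| * `|B|)).
  by apply: ler_sum => l _; rewrite normrM ler_pM// ler_norm_entry.
by rewrite sumr_const card_ord -mulrA mulr_natl.
Qed.

Lemma ler_norm_exp_mx_coeff A l :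
  `|exp_mx_coeff A l| <= exp_coeff (m%:R * `|A|) l.
Proof.
rewrite /exp_mx_coeff /exp_coeff /= mx_normZ mulrC normfV normr_nat.
rewrite ler_wpM2r ?invr_ge0//.
elim: l => [|l ih].
  rewrite !expr0; apply: ler_mx_norm => // i j.
  by rewrite mxE; case: (_ == _); rewrite ?normr1 ?normr0.
by rewrite !exprS (le_trans (ler_norm_mulmx _ _))// ler_wpM2l// mulr_ge0.
Qed.

Lemma is_cvg_series_exp_mx A : cvgn (series (exp_mx_coeff A)).
Proof.
apply: normed_cvg.
apply: (@series_le_cvg _ _ (exp_coeff (m%:R * `|A|))) => [l|l|l|].
- by rewrite /=.
- by apply: exp_coeff_ge0; rewrite mulr_ge0.
- exact: ler_norm_exp_mx_coeff.
- exact: is_cvg_series_exp_coeff.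
Qed.

Lemma cvg_exp_mx_entry A i j :
  (fun N => series (exp_mx_coeff A) N i j) @ \oo --> exp_mx A i j.
Proof.
apply: (@cvg_comp _ _ _ (series (exp_mx_coeff A)) (fun M : 'M[R]_m => M i j)
  _ (nbhs (exp_mx A))); first exact: is_cvg_series_exp_mx.
exact: coord_continuous.
Qed.

Lemma cvg_mulmx_entry (u v : nat -> 'M[R]_m) (U V : 'M[R]_m) :
  (forall i j, (fun N => u N i j) @ \oo --> U i j) ->
  (forall i j, (fun N => v N i j) @ \oo --> V i j) ->
  forall i j, (fun N => (u N * v N) i j) @ \oo --> (U * V) i j.
Proof.
move=> uU vV i j; rewrite mxE; under eq_fun do rewrite mxE.
apply: cvg_big => [|l _]; first exact: add_continuous.
by apply: cvgM; [exact: uU|exact: vV].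
Qed.

Lemma cvgn_inj (u : nat -> R) (a b : R) :
  u @ \oo --> a -> u @ \oo --> b -> a = b.
Proof. by move=> /cvg_lim <-// /cvg_lim <-. Qed.

Lemma exp_mx_eq A (M : 'M[R]_m) :
  (forall i j, (fun N => series (exp_mx_coeff A) N i j) @ \oo --> M i j) ->
  exp_mx A = M.
Proof.
move=> AM; apply/matrixP => i j.
exact: (@cvgn_inj _ _ _ (@cvg_exp_mx_entry A i j) (AM i j)).
Qed.

Lemma exp_mx0 : exp_mx 0 = 1.
Proof.
apply: exp_mx_eq => i j; apply: cvg_near_cst; near=> N.
have [N' ->] : exists N', N = N'.+1.
  by exists N.-1; rewrite prednK//; near: N; exists 1%N.
rewrite /series /= big_mkord big_ord_recl /= big1 ?addr0.
  by rewrite /exp_mx_coeff fact0 invr1 scale1r expr0.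
by move=> l _; rewrite /exp_mx_coeff /= expr0n /= scaler0.
Unshelve. all: by end_near. Qed.

Lemma comm_exp_mx A B : GRing.comm A B -> GRing.comm A (exp_mx B).
Proof.
move=> AB; apply/matrixP => i j.
have cAB N : GRing.comm A (series (exp_mx_coeff B) N).
  apply: commr_sum => l _; rewrite /GRing.comm -[_ * _]scalemxAr.
  by rewrite -[RHS]scalemxAl; congr (_ *: _); exact: commrX.
have cA i' j' : (fun _ : nat => A i' j') @ \oo --> A i' j' by exact: cvg_cst.
apply: (@cvgn_inj _ _ _ (@cvg_mulmx_entry _ _ _ _ cA (@cvg_exp_mx_entry B) i j)).
under eq_fun do rewrite cAB.
exact: (@cvg_mulmx_entry _ _ _ _ (@cvg_exp_mx_entry B) cA i j).
Qed.

Lemma comm_scale_mx (a b : R) A B :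
  GRing.comm A B -> GRing.comm (a *: A) (b *: B).
Proof.
move=> AB; rewrite /GRing.comm -[LHS]scalemxAl -[RHS]scalemxAl -!scalemxAr.
by rewrite !scalerA mulrC; congr (_ *: _); exact: AB.
Qed.

Lemma mul_sums (T : pzRingType) (a b : T ^nat) (N : nat) :
  (\sum_(i < N) a i) * (\sum_(j < N) b j) =
  \sum_(l < N) \sum_(i < l.+1) a (l - i)%N * b i +
  \sum_(i < N) \sum_(j < N | (N <= i + j)%N) a i * b j.
Proof.
rewrite big_distrlr /=.
have -> : \sum_(l < N) \sum_(i < l.+1) a (l - i)%N * b i =
    \sum_(i < N) \sum_(j < N | (i + j < N)%N) a i * b j.
  transitivity (\sum_(j < N) \sum_(l < N | (j <= l)%N) a (l - j)%N * b j).
    rewrite (exchange_big_dep xpredT) //=; apply: eq_bigr => l _.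
    rewrite (big_ord_widen_cond N xpredT (fun i => a (l - i)%N * b i))//.
  rewrite [RHS](exchange_big_dep xpredT) //=; apply: eq_bigr => j _.
  rewrite -(big_mkord (fun l => j <= l)%N (fun l => a (l - j)%N * b j)).
  rewrite -(big_mkord (fun l => l + j < N)%N (fun l => a l * b j)).
  rewrite (big_cat_nat _ (n := j)) //=; last exact: ltnW.
  rewrite big_nat_cond big_pred0 ?add0r; last first.
    by move=> l; apply/negP => /andP[/andP[_ /ltn_geF ->]].
  rewrite [RHS](big_cat_nat _ (n := (N - j)%N)) //= ?leq_subr//.
  rewrite [X in _ = _ + X]big_nat_cond [X in _ = _ + X]big_pred0 ?addr0; last first.
    move=> l; apply/negP => /andP[/andP[h _]].
    by rewrite leq_subLR addnC in h; rewrite ltnNge h.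
  rewrite -{1}[j : nat]add0n big_addn big_nat_cond [RHS]big_nat_cond.
  apply: eq_big => [l|l _]; last by rewrite addnK.
  by rewrite leq_addl andbT leq0n /= addnC -ltn_subRL andbb.
rewrite -big_split /=; apply: eq_bigr => i _.
rewrite (bigID (fun j : 'I_N => i + j < N)%N) /=; congr (_ + _).
by apply: eq_bigl => j; rewrite -leqNgt.
Qed.

Lemma inv_fact_bin (l i : nat) : (i <= l)%N ->
  (l`!%:R : R)^-1 *+ 'C(l, i) = ((l - i)`!%:R)^-1 * (i`!%:R)^-1.
Proof.
move=> il; have f0 p : (p`!%:R : R) != 0 by rewrite pnatr_eq0 -lt0n fact_gt0.
apply: (mulfI (f0 l)); rewrite mulrnAr divff// -(bin_fact il) !natrM.
by rewrite -invfM [X in _ / X]mulrC mulfK// mulf_neq0.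
Qed.

Lemma exp_mx_coeffD A B l : GRing.comm A B ->
  \sum_(i < l.+1) exp_mx_coeff A (l - i)%N * exp_mx_coeff B i =
  exp_mx_coeff (A + B) l.
Proof.
move=> AB; rewrite {3}/exp_mx_coeff exprDn_comm// scaler_sumr.
apply: eq_bigr => i _; rewrite /exp_mx_coeff -[_ * _]scalemxAl -scalemxAr scalerA.
by rewrite -inv_fact_bin ?leq_ord// -scalerMnr scalerMnl.
Qed.

Lemma exp_coeffD (x y : R) l :
  \sum_(i < l.+1) exp_coeff x (l - i)%N * exp_coeff y i = exp_coeff (x + y) l.
Proof.
rewrite [RHS]/exp_coeff /= exprDn mulr_suml.
apply: eq_bigr => i _; rewrite /exp_coeff /=.
by rewrite mulrACA -inv_fact_bin ?leq_ord// mulrnAr mulrnAl.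
Qed.

Lemma exp_mxD A B : GRing.comm A B -> exp_mx (A + B) = exp_mx A * exp_mx B.
Proof.
move=> AB; pose x := m%:R * `|A|; pose y := m%:R * `|B|.
pose D N := \sum_(i < N) \sum_(j < N | (N <= i + j)%N)
  exp_mx_coeff A i * exp_mx_coeff B j.
pose d N := \sum_(i < N) \sum_(j < N | (N <= i + j)%N)
  exp_coeff x i * exp_coeff y j.
have DE N : series (exp_mx_coeff A) N * series (exp_mx_coeff B) N =
    series (exp_mx_coeff (A + B)) N + D N.
  rewrite /series /= !big_mkord mul_sums; congr (_ + _).
  by apply: eq_bigr => l _; exact: exp_mx_coeffD.
have dE N : d N = series (exp_coeff x) N * series (exp_coeff y) N -
    series (exp_coeff (x + y)) N.
  rewrite /series /= !big_mkord mul_sums -[LHS](addKr (\sum_(i < N) exp_coeff (x + y) i)).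
  rewrite addrC; congr (_ + _ - _).
  by apply: eq_bigr => l _; rewrite exp_coeffD.
have d0 : m%:R * d N @[N --> \oo] --> 0.
  rewrite -(mulr0 m%:R) -(subrr (expR (x + y))) {1}expRD.
  under eq_fun do rewrite dE.
  apply: cvgM; first exact: cvg_cst.
  by apply: cvgB; [apply: cvgM|]; exact: is_cvg_series_exp_coeff.
have Dd N i j : `|D N i j| <= m%:R * d N.
  apply: le_trans (ler_norm_entry _ _ _) _; rewrite mulr_sumr.
  apply: le_trans (ler_norm_sum _ _ _) _; apply: ler_sum => p _.
  rewrite mulr_sumr.
  apply: le_trans (ler_norm_sum _ _ _) _; apply: ler_sum => q _.
  apply: le_trans (ler_norm_mulmx _ _) _; rewrite -mulrA ler_wpM2l//.
  by rewrite ler_pM// ler_norm_exp_mx_coeff.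
apply: exp_mx_eq => i j.
have D0 : (fun N => D N i j) @ \oo --> 0.
  apply: norm_cvg0; apply: (squeeze_cvgr _ (cvg_cst 0) d0).
  by apply: nearW => N; rewrite normr_ge0 Dd.
rewrite -[_ i j]subr0.
rewrite (_ : (fun N => _) = fun N =>
    (series (exp_mx_coeff A) N * series (exp_mx_coeff B) N) i j - D N i j).
  apply: cvgB D0; apply: cvg_mulmx_entry; exact: cvg_exp_mx_entry.
by apply/funext => N; rewrite DE !mxE addrK.
Qed.

End MatrixExponential.

(* The group R^k x| R^(s + 2n) attached to F. The parameters F and X do not
   affect the underlying space, only the group law below, through
   phi (sum_i t_i X_i) = prod_i exp (t_i ad_(X_i)), X being a basis of b. *)
Definition flat_group (R : realType) (k s n : nat)
    (F : flatLieAlgebra R k s n) (X : k.-tuple 'cV[R]_k) : Type :=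
  ('cV[R]_k * 'cV[R]_(s + 2 * n))%type.

Section FlatLieGroup.
Variables (R : realType) (k s n : nat).
Variables (F : flatLieAlgebra R k s n) (X : k.-tuple 'cV[R]_k).

Definition phi_mx (t : 'cV[R]_k) : 'M[R]_(s + 2 * n) :=
  \prod_(i < k) exp_mx (coord X i t *: ad_mx F (tnth X i)).

Lemma lie_br1 g h : (lie_br F g h).1 = 0.
Proof.
have : lie_derived (lie_br F) (lie_br F g h).
  by exists [:: (g, h)]; rewrite big_seq1.
by rewrite lie_derivedE => -[d _ <-].
Qed.

Lemma ad_mxE (x : 'cV[R]_k) (v : 'cV[R]_(s + 2 * n)) :
  lie_br F (x, 0) (0, v) = (0, ad_mx F x *m v).
Proof.
rewrite [LHS]surjective_pairing lie_br1; congr pair.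
have [linr _ _ _] := lie_brP F.
pose f (w : 'cV[R]_(s + 2 * n)) := (lie_br F (x, 0) (0, w)).2.
have lf : linear f.
  move=> a u w; rewrite /f.
  have -> : (0, a *: u + w) = a *: (0, u) + (0, w) :> 'cV[R]_k * 'cV[R]_(s + 2 * n).
    by apply: injective_projections; rewrite //= scaler0 addr0.
  by rewrite linr.
pose L : {linear 'cV[R]_(s + 2 * n) -> 'cV[R]_(s + 2 * n)} :=
  HB.pack f (GRing.isLinear.Build R _ _ _ f lf).
apply/colP => i; rewrite -[LHS]/(L v i 0) [v in L v]matrix_sum_delta.
rewrite linear_sum summxE mxE; apply: eq_bigr => j _.
by rewrite big_ord1 linearZ !mxE mulrC.
Qed.

Lemma comm_ad_mx x y : GRing.comm (ad_mx F x) (ad_mx F y).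
Proof.
have [linr linl alt jac] := lie_brP F.
have anti g h : lie_br F g h = - lie_br F h g.
  apply/eqP; rewrite -addr_eq0; have := alt (g + h).
  have addl a b c : lie_br F (a + b) c = lie_br F a c + lie_br F b c.
    by have := linl c 1 a b; rewrite !scale1r.
  have addr a b c : lie_br F a (b + c) = lie_br F a b + lie_br F a c.
    by have := linr a 1 b c; rewrite !scale1r.
  by rewrite addl !addr !alt add0r addr0 => ->.
have br0 g : lie_br F g 0 = 0.
  by have := linr g (-1) 0 0; rewrite !scaler0 addr0 scaleN1r addNr.
suff h (v : 'cV[R]_(s + 2 * n)) : ad_mx F x *m (ad_mx F y *m v) = ad_mx F y *m (ad_mx F x *m v).
  apply/matrixP => i j; have := h (delta_mx j 0).
  by rewrite !mulmxA -!colE => /colP/(_ i); rewrite !mxE.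
have := jac (x, 0) (y, 0) (0, v).
rewrite lie_b_abelian br0 addr0 (anti (0, v)) (ad_mxE x v).
have -> : - (0, ad_mx F x *m v) = (0, - (ad_mx F x *m v)) :> 'cV[R]_k * 'cV[R]_(s + 2 * n).
  by apply: injective_projections; rewrite //= oppr0.
rewrite !ad_mxE => /(congr1 snd) /= /eqP.
by rewrite mulmxN subr_eq0 => /eqP.
Qed.

Let comm_factor (a b : R) i j : GRing.comm
  (exp_mx (a *: ad_mx F (tnth X i))) (exp_mx (b *: ad_mx F (tnth X j))).
Proof.
apply/comm_exp_mx/commr_sym/comm_exp_mx.
exact/comm_scale_mx/comm_ad_mx.
Qed.

Lemma phi_mx0 : phi_mx 0 = 1.
Proof. by apply: big1 => i _; rewrite linear0 scale0r exp_mx0. Qed.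

Lemma phi_mxD t t' : phi_mx (t + t') = phi_mx t * phi_mx t'.
Proof.
rewrite /phi_mx -prodrM_comm => [|i j _ _]; last exact: comm_factor.
apply: eq_bigr => i _; rewrite linearD scalerDl exp_mxD//.
exact: comm_scale_mx.
Qed.

Local Notation flat_group := (flat_group F X).
HB.instance Definition _ := Topological.on flat_group.

Implicit Types g h : flat_group.

Definition flat_one : flat_group := (0, 0).
Definition flat_mul g h : flat_group := (g.1 + h.1, g.2 + phi_mx g.1 *m h.2).
Definition flat_inv g : flat_group := (- g.1, - (phi_mx (- g.1) *m g.2)).

Lemma flat_mulA : associative flat_mul.
Proof.
move=> g h l; rewrite /flat_mul /= addrA; congr pair.
by rewrite phi_mxD mulmxDr mulmxA addrA.
Qed.

Lemma flat_mul1g : left_id flat_one flat_mul.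
Proof. by case=> t v; rewrite /flat_mul /= phi_mx0 !add0r mul1mx. Qed.

Lemma flat_mulg1 : right_id flat_one flat_mul.
Proof. by case=> t v; rewrite /flat_mul /= mulmx0 !addr0. Qed.

Lemma flat_mulVg : left_inverse flat_one flat_inv flat_mul.
Proof. by case=> t v; rewrite /flat_mul /flat_inv /= !addNr. Qed.

Lemma flat_mulgV : right_inverse flat_one flat_inv flat_mul.
Proof.
case=> t v; rewrite /flat_mul /flat_inv /= subrr mulmxN mulmxA.
by rewrite -[phi_mx _ *m phi_mx _]phi_mxD subrr phi_mx0 mul1mx subrr.
Qed.

HB.instance Definition _ := isGroup.Build flat_group
  flat_mulA flat_mul1g flat_mulg1 flat_mulVg flat_mulgV.

End FlatLieGroup.

Definition GLZ (m : nat) : Type := {A : 'M[int]_m | A \in unitmx}.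

Section GLZ.
Variable m : nat.
Implicit Types A B : GLZ m.

HB.instance Definition _ := Choice.on (GLZ m).

Definition GLZ_one : GLZ m :=
  exist (fun M => M \in unitmx) _ (unitmx1 int m).

Lemma GLZ_mul_subproof A B : sval A *m sval B \in unitmx.
Proof. by rewrite unitmx_mul (svalP A) (svalP B). Qed.

Lemma GLZ_inv_subproof A : invmx (sval A) \in unitmx.
Proof. by rewrite unitmx_inv (svalP A). Qed.

Definition GLZ_mul A B : GLZ m :=
  exist (fun M => M \in unitmx) _ (GLZ_mul_subproof A B).
Definition GLZ_inv A : GLZ m :=
  exist (fun M => M \in unitmx) _ (GLZ_inv_subproof A).

Lemma GLZ_mulA : associative GLZ_mul.
Proof. by move=> A B C; apply: val_inj; rewrite /= mulmxA. Qed.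

Lemma GLZ_mul1g : left_id GLZ_one GLZ_mul.
Proof. by move=> A; apply: val_inj; rewrite /= mul1mx. Qed.

Lemma GLZ_mulg1 : right_id GLZ_one GLZ_mul.
Proof. by move=> A; apply: val_inj; rewrite /= mulmx1. Qed.

Lemma GLZ_mulVg : left_inverse GLZ_one GLZ_inv GLZ_mul.
Proof. by move=> A; apply: val_inj; rewrite /= mulVmx// (svalP A). Qed.

Lemma GLZ_mulgV : right_inverse GLZ_one GLZ_inv GLZ_mul.
Proof. by move=> A; apply: val_inj; rewrite /= mulmxV// (svalP A). Qed.

HB.instance Definition _ := isGroup.Build (GLZ m)
  GLZ_mulA GLZ_mul1g GLZ_mulg1 GLZ_mulVg GLZ_mulgV.

End GLZ.

Section Subgroups.
Local Open Scope group_scope.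

Definition is_subgroup (G : groupType) (A : set G) : Prop :=
  group_closed (mem A).

Definition generated_subgroup (G : groupType) (S : set G) : set G :=
  smallest (@is_subgroup G) S.

Variable G : groupType.
Implicit Types A B Gam Lam : set G.

Definition is_normal_abelian Gam A : Prop :=
  [/\ is_subgroup A, A `<=` Gam,
      forall a g, A a -> Gam g -> A (a ^ g)
    & forall a b, A a -> A b -> commute a b].

Definition is_maximal_normal_abelian Gam A : Prop :=
  is_normal_abelian Gam A /\
  forall B, is_normal_abelian Gam B -> A `<=` B -> B = A.

(* The translation subgroup of a Bieberbach group is its unique maximal normal
   abelian subgroup. *)
Definition is_translation_subgroup Gam Lam : Prop :=
  unique (is_maximal_normal_abelian Gam) Lam.

(* The quotient group Gam / Lam is the set of cosets of Lam in Gam, with the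
   product of subsets as group law. *)
Definition mulsets A B : set G := [set a * b | a in A & b in B].

Definition quotient_group Gam Lam : set (set G) :=
  [set [set g * l | l in Lam] | g in Gam].

Definition quotient_isog Gam Lam (K : groupType) (H : set K) : Prop :=
  exists2 f : set G -> K, set_bij (quotient_group Gam Lam) H f &
    {in quotient_group Gam Lam &, {morph f : C D / mulsets C D >-> C * D}}.

(* The holonomy group of the flat manifold Gam \ G is identified with
   Gam / Lam, where Lam is the translation subgroup of Gam. *)
Definition holonomy_isog Gam (K : groupType) (H : set K) : Prop :=
  exists2 Lam, is_translation_subgroup Gam Lam & quotient_isog Gam Lam H.

End Subgroups.

Section Lattices.
Variables (R : realType) (k s n : nat).
Variables (F : flatLieAlgebra R k s n) (X : k.-tuple 'cV[R]_k).

Definition is_lattice (Gam : set (flat_group F X)) : Prop :=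
  [/\ is_subgroup Gam, isolated Gam = Gam
    & exists2 C : set (flat_group F X), compact C
        & forall g, exists2 a, Gam a & exists2 c, C c & g = (a * c)%g].

Definition split_lattice (P : 'M[R]_(s + 2 * n)) : set (flat_group F X) :=
  [set ((\sum_(i < k) tnth X i *~ a i, P *m map_mx intr b) : flat_group F X) |
    a in [set: 'I_k -> int] & b in [set: 'cV[int]_(s + 2 * n)]].

End Lattices.
Arguments split_lattice {R k s n} F X P.

(* Main.v *)
(* Let Lam be the set of (t, v) in Gam with phi t = 1; it is normal and abelian.
   If (t, v) lies in a normal abelian subgroup of Gam, it commutes with its
   conjugates by the elements (0, P b), which gives (phi t - 1)^2 = 0. But
   phi t preserves the inner product, because each ad_x is skew, so phi t = 1.
   Hence Lam is the unique maximal normal abelian subgroup. It is the kernel of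
   (t, v) |-> P^-1 (phi t) P, whose image on Gam is generated by the E_i.
   Invertibility of E_i over the integers also comes from the isometry property:
   (det E_i)^2 = 1. *)
Require Import Defs.
From HB Require Import structures.
From mathcomp Require Import all_boot all_order all_algebra.
From mathcomp Require Import all_classical all_reals all_analysis.
Set Implicit Arguments.
Unset Strict Implicit.
Unset Printing Implicit Defensive.
Import Order.TTheory GRing.Theory Num.Theory.
Import numFieldNormedType.Exports.
Local Open Scope classical_set_scope.
Local Open Scope ring_scope.

(** * Isometries of an anisotropic bilinear form, and exponentials of skew matrices *)

Section Isometries.
Variables (R : realType) (m : nat).
Implicit Types A B C J U : 'M[R]_m.

Definition anisotropic J := forall v : 'cV[R]_m, v^T *m J *m v = 0 -> v = 0.

Definition isometry_mx J U : Prop := U^T *m J *m U = J.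

Lemma mulcV_inj (p : nat) (A B : 'M[R]_(m, p)) :
  (forall v : 'cV_p, A *m v = B *m v) -> A = B.
Proof.
move=> AB; apply/matrixP => i j; have := AB (delta_mx j 0).
by rewrite -!colE => /colP/(_ i); rewrite !mxE.
Qed.

Lemma isometry_mxM J U V :
  isometry_mx J U -> isometry_mx J V -> isometry_mx J (U *m V).
Proof.
move=> JU JV; rewrite /isometry_mx trmx_mul -!mulmxA (mulmxA J) (mulmxA U^T).
by rewrite [U^T *m _]mulmxA JU mulmxA.
Qed.

Lemma isometry_mx1 J : isometry_mx J 1%:M.
Proof. by rewrite /isometry_mx trmx1 mul1mx mulmx1. Qed.

(** Determinants are taken in [U^T *m J *m U = J]. A nonzero vector in the left kernel of [J] would
    be isotropic, so [\det J] cancels. *)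
Lemma isometry_det_sqr J U : anisotropic J -> isometry_mx J U -> \det U ^+ 2 = 1.
Proof.
move=> Jan /(congr1 determinant); rewrite !det_mulmx det_tr => dJ.
have J0 : \det J != 0.
  apply/negP => /det0P[v v0 vJ]; move/eqP: v0; apply.
  by apply/trmx_inj; rewrite trmx0; apply: Jan; rewrite trmxK vJ mul0mx.
by apply: (mulIf J0); rewrite mul1r expr2 mulrAC.
Qed.

(** For [N = U - 1], [N ^ 2 = 0] gives [U N = N], hence [N^T J N = U^T J U N - J N = 0]. Every [N v]
    is then isotropic, so it vanishes. *)
Lemma isometry_unipotent J U : anisotropic J -> isometry_mx J U ->
  (U - 1%:M) *m (U - 1%:M) = 0 -> U = 1%:M.
Proof.
move=> Jan JU NN; apply/eqP; rewrite -subr_eq0; apply/eqP.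
move: NN; set N := U - 1%:M => NN.
have UN : U *m N = N.
  by rewrite -[in LHS](subrK 1%:M U) mulmxDl mul1mx NN add0r.
have NJN : N^T *m J *m N = 0.
  have -> : N^T = U^T - 1%:M by rewrite linearB /= trmx1.
  rewrite !mulmxBl mul1mx -{1}UN !mulmxA JU.
  by rewrite subrr.
apply: mulcV_inj => v; rewrite mul0mx; apply: Jan.
by rewrite trmx_mul -!mulmxA (mulmxA J) (mulmxA N^T) (mulmxA N^T J) NJN mul0mx mulmx0.
Qed.

(** The relation passes to powers, then to partial sums of the series, then to the limit entry by
    entry. *)
Lemma exp_mx_intertwine C A B : C * A = B * C -> C * exp_mx A = exp_mx B * C.
Proof.
move=> CAB; apply/matrixP => i j.
have CX l : C * A ^+ l = B ^+ l * C.
  elim: l => [|l ih]; first by rewrite !expr0 mulr1 mul1r.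
  by rewrite exprS mulrA CAB -mulrA ih mulrA -exprS.
have CS N : C * series (exp_mx_coeff A) N = series (exp_mx_coeff B) N * C.
  rewrite /series /= mulr_sumr mulr_suml; apply: eq_bigr => l _.
  rewrite /exp_mx_coeff -[LHS]scalemxAr -[RHS]scalemxAl.
  by congr (_ *: _); exact: CX.
have cC i' j' : (fun _ : nat => C i' j') @ \oo --> C i' j' by exact: cvg_cst.
apply: (@cvgn_inj _ _ _ _ (@cvg_mulmx_entry _ _ _ _ _ _ cC (@cvg_exp_mx_entry _ _ A) i j)).
under eq_fun do rewrite CS.
exact: (@cvg_mulmx_entry _ _ _ _ _ _ (@cvg_exp_mx_entry _ _ B) cC i j).
Qed.

Lemma exp_mx_tr A : exp_mx A^T = (exp_mx A)^T.
Proof.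
apply: exp_mx_eq => i j; rewrite mxE.
rewrite (_ : (fun N => _) = fun N => series (exp_mx_coeff A) N j i).
  exact: cvg_exp_mx_entry.
apply/funext => N; rewrite /series /= !summxE; apply: eq_bigr => l _.
rewrite !mxE; congr (_ * _).
suff -> : A^T ^+ l = (A ^+ l)^T by rewrite mxE.
elim: l => [|l ih]; first by rewrite !expr0 trmx1.
by rewrite exprS ih exprSr trmx_mul.
Qed.

(** Skewness says that [J] intertwines [- A] and [A^T], so [(exp A)^T J exp A = J exp (- A) exp A =
    J]. *)
Lemma exp_skew_isometry J A :
  A^T *m J + J *m A = 0 -> isometry_mx J (exp_mx A).
Proof.
move=> /eqP; rewrite addr_eq0 => /eqP AJ.
have h : J * - A = A^T * J by rewrite mulrN -[RHS]/(A^T *m J) AJ.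
rewrite /isometry_mx -exp_mx_tr -[_ *m J](exp_mx_intertwine h).
rewrite -[LHS]/(J * exp_mx (- A) * exp_mx A) -mulrA -exp_mxD.
  by rewrite addNr exp_mx0 mulr1.
by rewrite /GRing.comm mulrN mulNr.
Qed.

End Isometries.

(** * The metric on [z(g) + [g, g]] as a Gram matrix, and skewness of [ad] there *)

Section AdjointSkew.
Variables (R : realType) (k s n : nat) (F : flatLieAlgebra R k s n).
Local Notation m := (s + 2 * n)%N.

Definition gram_mx : 'M[R]_m :=
  \matrix_(i, j) lie_ip F (0, delta_mx i 0) (0, delta_mx j 0).

Lemma scalar_sum_delta (f : 'cV[R]_m -> R) (v : 'cV[R]_m) :
  scalar f -> f v = \sum_j v j 0 * f (delta_mx j 0).
Proof.
move=> lf.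
pose L : {scalar 'cV[R]_m} := HB.pack f (GRing.isLinear.Build R _ _ _ f lf).
rewrite -[LHS]/(L v) [v in L v]matrix_sum_delta linear_sum.
by apply: eq_bigr => j _; rewrite big_ord1 linearZ.
Qed.

Lemma lie_ip_scalarl g : scalar (lie_ip F ^~ g).
Proof.
by have [lr ipC _] := lie_ipP F => a u v; rewrite ![lie_ip F _ g]ipC lr.
Qed.

Lemma snd_scalar (f : 'cV[R]_k * 'cV[R]_m -> R) :
  scalar f -> scalar (fun v => f (0, v)).
Proof.
move=> lf a u v; rewrite -lf; congr f.
by apply: injective_projections; rewrite //= scaler0 addr0.
Qed.

Lemma lie_ip_gram (v w : 'cV[R]_m) :
  lie_ip F (0, v) (0, w) = (v^T *m gram_mx *m w) 0 0.
Proof.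
have [lr _ _] := lie_ipP F.
rewrite (scalar_sum_delta w (snd_scalar (lr _))) mxE.
apply: eq_bigr => j _; rewrite mulrC; congr (_ * _).
rewrite (scalar_sum_delta v (snd_scalar (@lie_ip_scalarl _))) mxE.
by apply: eq_bigr => i _; rewrite !mxE.
Qed.

Lemma gram_anisotropic : anisotropic gram_mx.
Proof.
have [_ _ pos] := lie_ipP F.
move=> v vv; apply/eqP; apply: contraPT vv => v0 vv.
have := pos (0, v); rewrite lie_ip_gram vv mxE ltxx => /(_ _)/negP; apply=> //.
by rewrite xpair_eqE negb_and v0 orbT.
Qed.

Lemma lie_ip_addl g g' h : lie_ip F (g + g') h = lie_ip F g h + lie_ip F g' h.
Proof. by have := lie_ip_scalarl h 1 g g'; rewrite scale1r mul1r. Qed.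

Lemma lie_brC g h : lie_br F g h = - lie_br F h g.
Proof.
have [linr linl alt _] := lie_brP F.
have addl a b c : lie_br F (a + b) c = lie_br F a c + lie_br F b c.
  by have := linl c 1 a b; rewrite !scale1r.
have addr a b c : lie_br F a (b + c) = lie_br F a b + lie_br F a c.
  by have := linr a 1 b c; rewrite !scale1r.
apply/eqP; rewrite -addr_eq0; have := alt (g + h).
by rewrite addl !addr !alt add0r addr0 => ->.
Qed.

Lemma pair_split (c : 'cV[R]_s) (d : 'cV[R]_(2 * n)) :
  (0, col_mx c d) = (0, col_mx c 0) + (0, col_mx 0 d) :> 'cV[R]_k * 'cV[R]_m.
Proof.
by apply: injective_projections; rewrite /= ?addr0// add_col_mx addr0 add0r.
Qed.

Lemma lie_br_center g c : lie_br F g (0, col_mx c 0) = 0.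
Proof.
rewrite lie_brC; suff: lie_center (lie_br F) (0, col_mx c 0) by move=> ->; rewrite oppr0.
by rewrite lie_centerE; exists c.
Qed.

Lemma lie_br_derived g h : exists d, lie_br F g h = (0, col_mx 0 d).
Proof.
have : lie_derived (lie_br F) (lie_br F g h) by exists [:: (g, h)]; rewrite big_seq1.
by rewrite lie_derivedE => -[d _ <-]; exists d.
Qed.

(** Skewness is given on [[g, g]] only. It extends because central components are killed by the
    bracket and are orthogonal to [[g, g]], where all brackets lie. *)
Lemma lie_br_skew x (v w : 'cV[R]_m) :
  lie_ip F (lie_br F (x, 0) (0, v)) (0, w) +
  lie_ip F (0, v) (lie_br F (x, 0) (0, w)) = 0.
Proof.
have [linr _ _ _] := lie_brP F; have [_ ipC _] := lie_ipP F.
have bE (u : 'cV[R]_m) : lie_br F (x, 0) (0, u) =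
    lie_br F (x, 0) (0, col_mx 0 (dsubmx u)).
  rewrite -[u in LHS]vsubmxK pair_split.
  by have := linr (x, 0) 1 (0, col_mx (usubmx u) 0) (0, col_mx 0 (dsubmx u));
    rewrite !scale1r lie_br_center add0r.
have pE (u : 'cV[R]_m) d : lie_ip F (0, u) (0, col_mx 0 d) =
    lie_ip F (0, col_mx 0 (dsubmx u)) (0, col_mx 0 d).
  rewrite -[u in LHS]vsubmxK pair_split lie_ip_addl.
  by have [_ _ ->] := lie_orthE F 0 (usubmx u) d; rewrite add0r.
rewrite (bE v) (bE w).
apply: etrans (lie_ad_skew F x (dsubmx v) (dsubmx w)); congr (_ + _).
  have [d ->] := lie_br_derived (x, 0) (0, col_mx 0 (dsubmx v)).
  by rewrite ipC pE ipC.
by have [d ->] := lie_br_derived (x, 0) (0, col_mx 0 (dsubmx w)); rewrite pE.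
Qed.

Lemma ad_mx_skew x : (ad_mx F x)^T *m gram_mx + gram_mx *m ad_mx F x = 0.
Proof.
apply/matrixP => i j; have := lie_br_skew x (delta_mx i 0) (delta_mx j 0).
have dE (B : 'M[R]_m) :
    ((delta_mx i 0 : 'cV[R]_m)^T *m B *m (delta_mx j 0 : 'cV[R]_m)) 0 0 = B i j.
  by rewrite trmx_delta -rowE -colE !mxE.
rewrite !ad_mxE !lie_ip_gram trmx_mul -[_ *m (ad_mx F x)^T *m gram_mx]mulmxA.
by rewrite [_ *m (_ *m delta_mx j 0)]mulmxA -[_ *m gram_mx *m _]mulmxA !dE !mxE.
Qed.

Lemma exp_ad_isometry (a : R) x : isometry_mx gram_mx (exp_mx (a *: ad_mx F x)).
Proof.
apply: exp_skew_isometry.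
by rewrite linearZ /= -scalemxAl -scalemxAr -scalerDr ad_mx_skew scaler0.
Qed.

Lemma phi_mx_isometry (X : k.-tuple 'cV[R]_k) t :
  isometry_mx gram_mx (phi_mx F X t).
Proof.
apply: (big_ind (isometry_mx gram_mx)) => [|U V|i _].
- exact: isometry_mx1.
- exact: isometry_mxM.
- exact: exp_ad_isometry.
Qed.

End AdjointSkew.

(** * Subgroups of an abstract group, as sets *)

Section Subgroups.
Local Open Scope group_scope.
Variable G : groupType.
Implicit Types A Gam : set G.

Lemma is_subgroupP A : is_subgroup A <->
  A 1 /\ forall x y, A x -> A y -> A (x / y).
Proof.
split=> [[A1 AV]|[A1 AV]].
  split=> [|x y Ax Ay]; first exact: set_mem A1.
  by apply: set_mem; apply: AV; apply: mem_set.
split=> [|x y /set_mem Ax /set_mem Ay]; apply: mem_set => //; exact: AV.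
Qed.

Lemma subgroup1 A : is_subgroup A -> A 1.
Proof. by case/is_subgroupP. Qed.

Lemma subgroupV A x : is_subgroup A -> A x -> A x^-1.
Proof. by move=> /is_subgroupP[A1 AV] Ax; rewrite -div1g; exact: AV. Qed.

Lemma subgroupM A x y : is_subgroup A -> A x -> A y -> A (x * y).
Proof.
move=> sA Ax Ay; rewrite -[y]invgK.
by have /is_subgroupP[_ AV] := sA; apply: AV => //; exact: subgroupV.
Qed.

Lemma generated_subgroup_is_subgroup A : is_subgroup (generated_subgroup A).
Proof.
apply/is_subgroupP; split=> [B [/subgroup1]//|x y xA yA B [sB AB]].
by have /is_subgroupP[_] := sB; apply; [exact: xA|exact: yA].
Qed.

(** A greatest normal abelian subgroup is the unique maximal one: any maximal [A] lies in [Lam], and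
    its own maximality forces equality. *)
Lemma translation_subgroupP Gam Lam :
  is_normal_abelian Gam Lam ->
  (forall A, is_normal_abelian Gam A -> A `<=` Lam) ->
  is_translation_subgroup Gam Lam.
Proof.
move=> nLam maxLam; split.
  by split=> // B nB LB; apply/seteqP; split=> //; exact: maxLam.
by move=> A [nA /(_ _ nLam)]; apply; exact: maxLam.
Qed.

(** * First isomorphism theorem for a map that is multiplicative on [Gam] only *)

Section Homomorphism.
Variables (Gam : set G) (K : groupType) (rho : G -> K).
Hypothesis sGam : is_subgroup Gam.
Hypothesis rhoM : forall g h, Gam g -> Gam h -> rho (g * h) = rho g * rho h.
Local Notation Lam := [set g | Gam g /\ rho g = 1].

Lemma morph_subgroup1 : rho 1 = 1.
Proof.
apply: (mulgI (rho 1)); rewrite mulg1 -rhoM ?mulg1//; exact: subgroup1.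
Qed.

Lemma morph_subgroupV g : Gam g -> rho g^-1 = (rho g)^-1.
Proof.
move=> Gg; apply: (mulgI (rho g)); rewrite -rhoM ?mulgV ?morph_subgroup1//.
exact: subgroupV.
Qed.

Lemma kernel_subgroup : is_subgroup Lam.
Proof.
apply/is_subgroupP; split=> [|g h [Gg g1] [Gh h1]].
  by split; [exact: subgroup1|exact: morph_subgroup1].
have GV : Gam h^-1 by exact: subgroupV.
split; first exact: (subgroupM sGam).
by rewrite rhoM// morph_subgroupV// g1 h1 mulgV.
Qed.

Lemma kernel_conj a g : Lam a -> Gam g -> Lam (a ^ g).
Proof.
move=> [Ga a1] Gg; have GV : Gam g^-1 by exact: subgroupV.
have Gag : Gam (a * g) by exact: subgroupM.
split; first exact: (subgroupM sGam).
by rewrite conjgE !rhoM// a1 mul1g morph_subgroupV// mulVg.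
Qed.

(** The cosets of the kernel in [Gam] are the fibers of [rho] on [Gam], so [rho] descends to an
    injective map on cosets. *)
Lemma first_isomorphism : quotient_isog Gam Lam (rho @` Gam).
Proof.
pose coset g := [set g * l | l in Lam].
have cosetP g h : Gam g -> coset g h <-> Gam h /\ rho h = rho g.
  move=> Gg; split=> [[l [Gl l1] <-]|[Gh hg]].
    by rewrite rhoM// l1 mulg1; split=> //; exact: subgroupM.
  exists (g^-1 * h); last by rewrite mulVKg.
  have GV : Gam g^-1 by exact: subgroupV.
  split; first exact: (subgroupM sGam).
  by rewrite rhoM// hg -rhoM// mulVg morph_subgroup1.
have coset_id g : Gam g -> coset g g by move=> Gg; apply/cosetP.
(* [rho] is constant on a coset, so the choice is forced there; the default [1] is reached only when
   [C] is empty. *)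
pose f C := xget 1 (rho @` C).
have fE g : Gam g -> f (coset g) = rho g.
  move=> Gg; have [h gh <-] : (rho @` coset g) (f (coset g)).
    by apply: (@xgetI _ _ _ (rho g)); exists g => //; exact: coset_id.
  by have [_] := (cosetP g h Gg).1 gh.
have mulE g h : Gam g -> Gam h -> mulsets (coset g) (coset h) = coset (g * h).
  move=> Gg Gh; have Ggh : Gam (g * h) by exact: subgroupM.
  apply/seteqP; split=> [_ [a + [b + <-]]|x].
    move=> /(cosetP _ _ Gg)[Ga ag] /(cosetP _ _ Gh)[Gb bh].
    by apply/cosetP => //; rewrite !rhoM// ag bh; split=> //; exact: subgroupM.
  move=> [l Ll <-]; exists g; first exact: coset_id.
  by exists (h * l); [exists l|rewrite mulgA].
exists f => [|C D]; last first.
  rewrite !inE => -[g Gg <-] [h Gh <-]; rewrite -/(coset g) -/(coset h).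
  by rewrite mulE// !fE// ?rhoM//; exact: subgroupM.
split=> [_ [g Gg <-]|C D|_ [g Gg <-]].
- by rewrite -/(coset g) fE//; exists g.
- rewrite !inE => -[g Gg <-] [h Gh <-]; rewrite -/(coset g) -/(coset h) !fE// => gh.
  by apply/seteqP; split=> x /cosetP => /(_ _)[]// Gx xE; apply/cosetP; rewrite // xE gh.
- by exists (coset g); [exists g|exact: fE].
Qed.

End Homomorphism.

End Subgroups.

Lemma mulmx_inv_uniq (R : pzRingType) m (A B C : 'M[R]_m) :
  A *m B = 1%:M -> B *m C = 1%:M -> A = C.
Proof. by move=> AB BC; rewrite -[A]mulmx1 -BC mulmxA AB mul1mx. Qed.

(** Used to carry the existence of an integral matrix from the [X_i] to all their integer
    combinations. *)
Lemma int_span_ind (V : zmodType) (I : finType) (T : V -> Prop) (x : I -> V)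
    (a : I -> int) :
  T 0 -> (forall u v, T u -> T v -> T (u + v)) -> (forall u, T u -> T (- u)) ->
  (forall i, T (x i)) -> T (\sum_i x i *~ a i).
Proof.
move=> T0 TD TN Tx; apply: (big_ind T) => // i _.
have Tn l : T (x i *+ l) by elim: l => [|l ih] //; rewrite mulrS; exact: TD.
(* A negative coefficient [Negz l] is [-(l + 1)], whence the use of [TN] on top of [Tn]. *)
by case: (a i) => l; [exact: Tn|apply/TN/Tn].
Qed.

(** * The split lattice and the integral matrices that represent [phi] on it *)

Section SplitLattice.
Variables (R : realType) (k s n : nat).
Variables (F : flatLieAlgebra R k s n) (X : k.-tuple 'cV[R]_k).
Local Notation m := (s + 2 * n)%N.
Variable P : 'M[R]_m.
Hypotheses (X_basis : basis_of fullv X) (P_unit : P \in unitmx).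
Local Notation Gam := (split_lattice F X P).
Local Notation phi := (phi_mx F X).

(** The coordinates of [X_i] in the basis are Kronecker deltas, so every other factor is
    [exp 0 = 1]. *)
Lemma phi_mx_basis i : phi (tnth X i) = exp_mx (ad_mx F (tnth X i)).
Proof.
have fX := basis_free X_basis.
rewrite /phi_mx (eq_bigr (fun j => if j == i then exp_mx (ad_mx F (tnth X i)) else 1)).
  by rewrite -big_mkcond big_pred1_eq.
move=> j _; rewrite {1}(tnth_nth 0 X i) coord_free// eq_sym.
by case: eqP => [->|_]; rewrite ?scale1r// scale0r exp_mx0.
Qed.

Lemma split_lattice_fiber (b : 'cV[int]_m) : Gam (0, P *m map_mx intr b).
Proof. by exists (fun=> 0) => //; exists b => //; rewrite big1. Qed.

Lemma split_lattice_base i : Gam (tnth X i, 0).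
Proof.
exists (fun j => (j == i)%:Z) => //; exists 0 => //.
rewrite map_mx0 mulmx0 (bigD1 i)//= eqxx mulr1z big1 ?addr0// => j /negPf->.
by rewrite mulr0z.
Qed.

Lemma normal_abelian_phi (A : set (flat_group F X)) :
  is_normal_abelian Gam A -> forall g, A g -> phi g.1 = 1%:M.
Proof.
case=> _ _ nA cA [t v] Ag /=; pose N := phi t - 1%:M.
apply: (isometry_unipotent (@gram_anisotropic _ _ _ _ F)).
  exact: phi_mx_isometry.
have phiN (b : 'cV[int]_m) : N *m (N *m (P *m map_mx intr b)) = 0.
  set w := P *m _.
  (* The conjugate is checked after multiplying by [(0, w)] on the left, which avoids computing the
     inverse. *)
  have gE : (((t, v) : flat_group F X) ^ ((0, w) : flat_group F X))%g =
      (t, v + N *m w) :> flat_group F X.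
    apply: (mulgI ((0, w) : flat_group F X)); rewrite -conjgC.
    apply: injective_projections => /=; first by rewrite addr0 add0r.
    by rewrite phi_mx0 mul1mx /N mulmxBl mul1mx addrCA addrC [w + _]addrC subrK addrC.
  have := nA _ _ Ag (split_lattice_fiber b); rewrite -/w gE => Ah.
  (* Commutation of [(t, v)] with [(t, v + N w)] reduces to [phi t (N w) = N w], that is
     [N (N w) = 0]. *)
  have /(congr1 snd) /= := cA _ _ Ag Ah.
  rewrite mulmxDr addrA [X in _ = X]addrAC => /addrI h.
  by rewrite {1}/N mulmxBl mul1mx h subrr.
(* Taking for [b] the canonical basis vectors gives the columns of [P], which is then cancelled. *)
have NNP : N *m N *m P = 0.
  apply/matrixP => i j; have := phiN (delta_mx j 0).
  by rewrite map_delta_mx !mulmxA -colE => /colP/(_ i); rewrite !mxE.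
by rewrite -[LHS](mulmxK P_unit) NNP mul0mx.
Qed.

Lemma mulmx_phi t t' : phi t *m phi t' = phi (t + t').
Proof. by rewrite phi_mxD. Qed.

Lemma conj_mxM (U V : 'M[R]_m) :
  (invmx P *m U *m P) *m (invmx P *m V *m P) = invmx P *m (U *m V) *m P.
Proof. by rewrite -!mulmxA mulKVmx. Qed.

(** A relation and not a function of [t], since the real matrix on the right need not be integral
    for arbitrary [t]. *)
Definition int_model (t : 'cV[R]_k) (M : GLZ m) : Prop :=
  map_mx intr (sval M) = invmx P *m phi t *m P.

Lemma int_model_inj t M M' : int_model t M -> int_model t M' -> M = M'.
Proof.
move=> tM tM'; apply: val_inj; apply/matrixP => i j.
have /matrixP/(_ i j) : map_mx intr (sval M) = map_mx intr (sval M') :> 'M[R]_m.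
  by rewrite tM tM'.
by rewrite !mxE => /intr_inj.
Qed.

Lemma int_model0 : int_model 0 1%g.
Proof. by rewrite /int_model phi_mx0 mulmx1 mulVmx//= map_mx1. Qed.

Lemma int_modelD t t' M M' :
  int_model t M -> int_model t' M' -> int_model (t + t') (M * M')%g.
Proof.
move=> tM tM'; rewrite /int_model -mulmx_phi -conj_mxM -tM -tM'.
exact: map_mxM.
Qed.

(** The image of the integral inverse is a left inverse of [P^-1 (phi t) P], and
    [P^-1 (phi (- t)) P] is a right inverse, so they agree. *)
Lemma int_modelN t M : int_model t M -> int_model (- t) M^-1%g.
Proof.
move=> tM; rewrite /int_model -[LHS]/(map_mx intr (invmx (sval M))).
have MM : map_mx intr (invmx (sval M)) *m (invmx P *m phi t *m P) = 1%:M :> 'M[R]_m.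
  by rewrite -tM -map_mxM mulVmx ?map_mx1// (svalP M).
have tt : (invmx P *m phi t *m P) *m (invmx P *m phi (- t) *m P) = 1%:M.
  by rewrite conj_mxM mulmx_phi subrr phi_mx0 mulmx1 mulVmx.
exact: mulmx_inv_uniq MM tt.
Qed.

Lemma int_model_eq1 t M : int_model t M -> (M = 1%g) <-> (phi t = 1%:M).
Proof.
move=> tM; split=> [M1|t1].
  have := tM; rewrite M1 /int_model /= map_mx1 => /(congr1 (fun Q => P *m Q *m invmx P)).
  by rewrite mulmx1 mulmxV// !mulmxA mulmxV// mul1mx mulmxK.
by apply: (int_model_inj tM); rewrite /int_model t1 mulmx1 mulVmx//= map_mx1.
Qed.

Lemma int_model_unitmx (E : 'M[int]_m) t :
  map_mx intr E = invmx P *m phi t *m P -> E \in unitmx.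
Proof.
(* The determinant is its own inverse: conjugation by [P] does not change it, and that of an
   isometry squares to 1. *)
move=> Et; rewrite unitmxE; apply/unitrPr; exists (\det E).
apply: (@intr_inj R); rewrite intrM -expr2 -det_map_mx Et !det_mulmx mulrAC.
rewrite -det_mulmx mulVmx// det1 mul1r.
exact: (isometry_det_sqr (@gram_anisotropic _ _ _ _ F) (phi_mx_isometry _ _ _)).
Qed.

(** * The holonomy representation of the lattice, its image and its kernel *)

Section Holonomy.
Variable e : 'I_k -> GLZ m.
Hypothesis eP : forall i, int_model (tnth X i) (e i).
Hypothesis sGam : is_subgroup Gam.
Local Notation H := (generated_subgroup (range e)).

(** Having a model inside [H] is stable under sums and opposites of [t], and [e i] is such a model
    for [X_i]. *)
Lemma int_model_base (a : 'I_k -> int) :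
  exists2 M, H M & int_model (\sum_(i < k) tnth X i *~ a i) M.
Proof.
have sH : is_subgroup H by exact: generated_subgroup_is_subgroup.
apply: (@int_span_ind _ _ (fun t => exists2 M, H M & int_model t M)).
- by exists 1%g; [exact: (subgroup1 sH)|exact: int_model0].
- move=> t t' [M HM tM] [M' HM' tM'].
  by exists (M * M')%g; [exact: (subgroupM sH)|exact: int_modelD].
- move=> t [M HM tM].
  by exists M^-1%g; [exact: (subgroupV sH)|exact: int_modelN].
- by move=> i; exists (e i) => //; apply: sub_gen_smallest; exists i.
Qed.

(** Models are unique, so [xget] makes no real choice; the default [1] is not reached on [Gam],
    where a model exists. *)
Definition holonomy_rep (g : flat_group F X) : GLZ m :=
  xget 1%g (int_model g.1).

Lemma holonomy_repP g : Gam g -> H (holonomy_rep g) /\ int_model g.1 (holonomy_rep g).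
Proof.
move=> [a _ [b _ <-]]; have [M HM aM] := int_model_base a.
rewrite /holonomy_rep /=.
have h : int_model (\sum_(i < k) tnth X i *~ a i)
    (xget 1%g (int_model (\sum_(i < k) tnth X i *~ a i))) by exact: (xgetI _ aM).
by split=> //; rewrite (int_model_inj h aM).
Qed.

Lemma holonomy_repE g M : Gam g -> int_model g.1 M -> holonomy_rep g = M.
Proof. by move=> /holonomy_repP[_ h]; exact: int_model_inj. Qed.

Lemma holonomy_repM g h : Gam g -> Gam h ->
  holonomy_rep (g * h)%g = (holonomy_rep g * holonomy_rep h)%g.
Proof.
move=> Gg Gh; apply: holonomy_repE; first exact: (subgroupM sGam).
by apply: int_modelD; have [] := holonomy_repP Gg; have [] := holonomy_repP Gh.
Qed.

(** One inclusion holds since models over [Gam] lie in [H]; the other by minimality of [H], as the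
    image is a subgroup containing each [e i], the value at [(X_i, 0)]. *)
Lemma holonomy_rep_image : holonomy_rep @` Gam = H.
Proof.
apply/seteqP; split=> [_ [g /holonomy_repP[Hg _] <-]//|].
apply: smallest_sub => [|_ [i _ <-]]; last first.
  exists (tnth X i, 0); first exact: split_lattice_base.
  by apply: holonomy_repE; [exact: split_lattice_base|exact: eP].
apply/is_subgroupP; split=> [|_ _ [g Gg <-] [h Gh <-]].
  exists 1%g; first exact: (subgroup1 sGam).
  by apply: holonomy_repE; [exact: (subgroup1 sGam)|exact: int_model0].
have GV : Gam h^-1%g by exact: (subgroupV sGam).
exists (g / h)%g; first exact: (subgroupM sGam).
rewrite holonomy_repM//; congr (_ * _)%g; apply: holonomy_repE => //.
by apply: int_modelN; have [] := holonomy_repP Gh.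
Qed.

Lemma holonomy_rep_eq1 g : Gam g -> holonomy_rep g = 1%g <-> phi g.1 = 1%:M.
Proof. by move=> /holonomy_repP[_ /int_model_eq1]. Qed.

Lemma holonomy_rep_kernel :
  is_translation_subgroup Gam [set g | Gam g /\ holonomy_rep g = 1%g].
Proof.
apply: translation_subgroupP => [|A nA g Ag]; last first.
  have Gg : Gam g by have [_ AG _ _] := nA; exact: AG.
  by split=> //; apply/holonomy_rep_eq1 => //; exact: normal_abelian_phi nA _ Ag.
split=> [|g []//|a g [Ga a1] Gg
  |a b [Ga /holonomy_rep_eq1-/(_ Ga)a1] [Gb /holonomy_rep_eq1-/(_ Gb)b1]].
- exact: (kernel_subgroup sGam holonomy_repM).
- by apply: (kernel_conj sGam holonomy_repM).
(* Where [phi] is trivial the group law is componentwise addition. *)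
- rewrite /commute; apply: injective_projections => /=; first exact: addrC.
  by rewrite a1 b1 !mul1mx addrC.
Qed.

Lemma split_lattice_holonomy : holonomy_isog Gam H.
Proof.
exists [set g | Gam g /\ holonomy_rep g = 1%g]; first exact: holonomy_rep_kernel.
by rewrite -holonomy_rep_image; apply: first_isomorphism => //; exact: holonomy_repM.
Qed.

End Holonomy.
End SplitLattice.

Theorem proposition3p7 (R : realType) (k s n : nat)
    (F : flatLieAlgebra R k s n) (X : k.-tuple 'cV[R]_k)
    (P : 'M[R]_(s + 2 * n)) (E : 'I_k -> 'M[int]_(s + 2 * n))
    (X_basis : basis_of fullv X) (P_unit : P \in unitmx)
    (Gam_lattice : is_lattice (split_lattice F X P))
    (E_def : forall i,
       map_mx intr (E i) = invmx P *m exp_mx (ad_mx F (tnth X i)) *m P) :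
  exists2 e : 'I_k -> GLZ (s + 2 * n), (forall i, sval (e i) = E i)
    & holonomy_isog (split_lattice F X P) (generated_subgroup (range e)).
Proof.
have Ephi i : map_mx intr (E i) = invmx P *m phi_mx F X (tnth X i) *m P.
  by rewrite phi_mx_basis.
have Eunit i := int_model_unitmx P_unit (Ephi i).
exists (fun i => exist (fun M => M \in unitmx) (E i) (Eunit i)) => //.
have [sGam _ _] := Gam_lattice.
exact: split_lattice_holonomy.
Qed.
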